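(* If $m\ge 1$, then $$F_m(x,y,q)=\frac{1}{1-\sum_{a=1}^m\left(\dfrac{x^ay}{1-x^m-x^ay(q-1)}\right)}.$$
   Context: A composition of a positive integer $n$ with $d$ parts is a sequence $\pi=\pi_1\pi_2\cdots\pi_d$ of positive integers with $\pi_1+\cdots+\pi_d=n$; $\mathcal{C}_{n,d}$ is the set of compositions of $n$ with exactly $d$ parts. By convention there is one composition of $0$, the empty one, having zero parts (so $\mathcal{C}_{0,0}$ consists of the empty composition and $\mathcal{C}_{n,0}=\emptyset$ for $n\ge1$). For $m\ge1$, $\pi$ has an $m$-congruence succession at index $i$ ($1\le i\le d-1$) if $\pi_{i+1}\equiv\pi_i\pmod m$. Let $cl_m(\pi)$ be the number of $m$-congruence successions of $\pi$ (equal to $0$ for the empty composition). Define the formal power series $$F_m(x,y,q)=\sum_{n\ge0}\sum_{d=0}^n x^ny^d\left(\sum_{\pi\in\mathcal{C}_{n,d}}q^{cl_m(\pi)}\right).$$ The identity is one of formal power series in $x,y$ with coefficients in $\mathbb{Z}[q]$. *)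

(* Defs.v *)
From HB Require Import structures.
From mathcomp Require Import all_boot all_order all_algebra.
From mathcomp Require Import boolp.

Set Implicit Arguments.
Unset Strict Implicit.
Unset Printing Implicit Defensive.

Import GRing.Theory.
Local Open Scope ring_scope.

(** * Formal power series

    [fps R] is R[[t]], a series being its sequence of coefficients (through a
    coercion, [f n] is the coefficient of t^n).  Two-variable series are
    iterated ones, as {poly {poly R}} is for polynomials:
    R[[x, y]] = R[[y]][[x]] is [fps (fps R)], where [f n d] is the
    coefficient of x^n y^d. *)

Record fps (R : Type) := Fps { coefs :> nat -> R }.

HB.instance Definition _ (R : Type) := gen_eqMixin (fps R).
HB.instance Definition _ (R : Type) := gen_choiceMixin (fps R).

Lemma fpsP (R : Type) (f g : fps R) : (forall n, f n = g n) -> f = g.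
Proof. by case: f g => [f] [g] /= /funext ->. Qed.

Section FpsRing.
Variable R : comNzRingType.
Implicit Types f g h : fps R.

Definition fpsC (c : R) : fps R := Fps (fun n => if n == 0%N then c else 0).
Definition fpsX : fps R := Fps (fun n => (n == 1%N)%:R).

Definition fps_add f g := Fps (fun n => f n + g n).
Definition fps_opp f := Fps (fun n => - f n).
Definition fps_mul f g := Fps (fun n => \sum_(i < n.+1) f i * g (n - i)%N).

Fact fps_addA : associative fps_add.
Proof. by move=> f g h; apply: fpsP => n /=; rewrite addrA. Qed.
Fact fps_addC : commutative fps_add.
Proof. by move=> f g; apply: fpsP => n /=; rewrite addrC. Qed.
Fact fps_add0 : left_id (fpsC 0) fps_add.
Proof. by move=> f; apply: fpsP => n /=; rewrite if_same add0r. Qed.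
Fact fps_addN : left_inverse (fpsC 0) fps_opp fps_add.
Proof. by move=> f; apply: fpsP => n /=; rewrite if_same addNr. Qed.

HB.instance Definition _ :=
  GRing.isZmodule.Build (fps R) fps_addA fps_addC fps_add0 fps_addN.

Let trunc n f : {poly R} := \poly_(i < n.+1) f i.

Let coef_trunc n f k : (k <= n)%N -> (trunc n f)`_k = f k.
Proof. by move=> le_kn; rewrite coef_poly ltnS le_kn. Qed.

Let coef_truncM n f g k :
  (k <= n)%N -> (trunc n f * trunc n g)`_k = fps_mul f g k.
Proof.
move=> le_kn; rewrite coefM; apply: eq_bigr => i _.
rewrite !coef_trunc ?(leq_trans (leq_subr _ _)) //.
by apply: leq_trans le_kn; rewrite -ltnS.
Qed.

Fact fps_mulC : commutative fps_mul.
Proof.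
by move=> f g; apply: fpsP => n; rewrite -!(coef_truncM _ _ (leqnn n)) mulrC.
Qed.

Fact fps_mulA : associative fps_mul.
Proof.
move=> f g h; apply: fpsP => n.
transitivity (trunc n f * (trunc n g * trunc n h))`_n.
  rewrite coefM; apply: eq_bigr => i _.
  by rewrite coef_truncM ?leq_subr // coef_trunc // -ltnS.
rewrite mulrA coefM; apply: eq_bigr => i _.
by rewrite coef_truncM ?coef_trunc ?leq_subr // -ltnS.
Qed.

Fact fps_mul1 : left_id (fpsC 1) fps_mul.
Proof.
move=> f; apply: fpsP => n /=.
by rewrite big_ord_recl /= subn0 mul1r big1 ?addr0 // => i _; rewrite mul0r.
Qed.

Fact fps_mulDl : left_distributive fps_mul fps_add.
Proof.
move=> f g h; apply: fpsP => n /=.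
by rewrite -big_split; apply: eq_bigr => i _; rewrite mulrDl.
Qed.

Fact fps_one_neq0 : fpsC 1 != 0 :> fps R.
Proof.
by apply/eqP => /(congr1 (fun f : fps R => f 0%N)) /= /eqP; rewrite oner_eq0.
Qed.

HB.instance Definition _ :=
  GRing.Zmodule_isComNzRing.Build (fps R)
    fps_mulA fps_mulC fps_mul1 fps_mulDl fps_one_neq0.

Lemma coef0_fpsM f g : (f * g) 0%N = f 0%N * g 0%N.
Proof. by rewrite [LHS]big_ord1. Qed.

Lemma coef0_fpsB f g : (f - g) 0%N = f 0%N - g 0%N.
Proof. by []. Qed.

Lemma coef0_fpsXn f n : (f ^+ n) 0%N = f 0%N ^+ n.
Proof. by elim: n => // n IHn; rewrite !exprS coef0_fpsM IHn. Qed.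

Lemma coef0_fps_sum (I : Type) (r : seq I) (P : pred I) (f_ : I -> fps R) :
  (\sum_(i <- r | P i) f_ i) 0%N = \sum_(i <- r | P i) f_ i 0%N.
Proof. exact: (big_morph (fun f : fps R => f 0%N)). Qed.

End FpsRing.

Arguments fpsX {R}.

Section FpsInverse.
Variable R : comUnitRingType.
Implicit Types f g : fps R.

(* A series is invertible iff its constant coefficient is; the inverse g of f
   then satisfies f_0 g_n = [n = 0] - \sum_(0 < i <= n) f_i g_(n-i).
   [fps_inv_seq f n] lists g_0, ..., g_(n-1). *)
Fixpoint fps_inv_seq f n : seq R :=
  if n is n'.+1 then
    let s := fps_inv_seq f n' in
    rcons s ((f 0%N)^-1 *
      ((n' == 0%N)%:R - \sum_(i < n') f i.+1 * s`_(n' - i.+1)%N))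
  else [::].

Definition fps_unit : {pred fps R} := fun f => f 0%N \is a GRing.unit.

(* As for every unitRingType, the inverse of a non-unit is itself. *)
Definition fps_inv f : fps R :=
  if f 0%N \is a GRing.unit then Fps (fun n => (fps_inv_seq f n.+1)`_n) else f.

Let size_inv_seq f n : size (fps_inv_seq f n) = n.
Proof. by elim: n => //= n IHn; rewrite size_rcons IHn. Qed.

Let nth_inv_seq f n k :
  (k < n)%N -> (fps_inv_seq f n)`_k = (fps_inv_seq f k.+1)`_k.
Proof.
elim: n => // n IHn; rewrite ltnS leq_eqVlt => /predU1P[-> // | lt_kn].
by rewrite -IHn //= nth_rcons size_inv_seq lt_kn.
Qed.

Fact fps_mulV : {in fps_unit, left_inverse 1 fps_inv *%R}.
Proof.
move=> f Uf; rewrite mulrC; apply: fpsP => n.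
rewrite [LHS]big_ord_recl subn0 /fps_inv (Uf : f 0%N \is a _).
rewrite [coefs _ n]/= nth_rcons size_inv_seq ltnn eqxx mulrA divrr // mul1r.
rewrite [X in _ + X](_ : _ =
    \sum_(i < n) f i.+1 * (fps_inv_seq f n)`_(n - i.+1)%N).
  by rewrite subrK; case: n.
apply: eq_bigr => i _; congr (_ * _).
rewrite [in RHS]nth_inv_seq //.
by rewrite ltn_subrL /= (leq_ltn_trans _ (ltn_ord i)).
Qed.

Fact fps_unitPl f g : g * f = 1 -> fps_unit f.
Proof.
move=> /(congr1 (fun h : fps R => h 0%N)); rewrite coef0_fpsM => gf1.
by apply/unitrPr; exists (g 0%N); rewrite mulrC.
Qed.

Fact fps_inv_out : {in [predC fps_unit], fps_inv =1 id}.
Proof.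
by move=> f; rewrite inE /= /fps_inv => /negPf; rewrite unfold_in => ->.
Qed.

HB.instance Definition _ :=
  GRing.ComNzRing_hasMulInverse.Build (fps R) fps_mulV fps_unitPl fps_inv_out.

Lemma fps_unitE f : (f \is a GRing.unit) = (f 0%N \is a GRing.unit).
Proof. by []. Qed.

End FpsInverse.

(** * Compositions *)

Definition is_composition (n d : nat) (p : seq nat) : bool :=
  [&& size p == d, all (leq 1) p & sumn p == n].

Definition parts (n d : nat) (t : d.-tuple 'I_n.+1) : seq nat :=
  [seq val i | i <- t].

(* The parts of a composition of n are at most n, so that C_{n,d} is a subset
   of the finite type of d-tuples over {0, ..., n}. *)
Definition compositions (n d : nat) : {set d.-tuple 'I_n.+1} :=
  [set t | is_composition n d (parts t)].

Lemma parts_inj (n d : nat) : injective (@parts n d).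
Proof. by move=> s t /(inj_map val_inj) /val_inj. Qed.

Lemma is_compositionP (n d : nat) (p : seq nat) :
  is_composition n d p <-> exists2 t, t \in compositions n d & parts t = p.
Proof.
split=> [comp_p | [t]]; last by rewrite inE => ? <-.
have [/eqP sz_p _ /eqP sum_p] := and3P comp_p.
have sz_t : size [seq inord i : 'I_n.+1 | i <- p] == d by rewrite size_map sz_p.
have Et : parts (Tuple sz_t) = p.
  rewrite /parts /= -map_comp -[RHS]map_id; apply/eq_in_map => i p_i /=.
  by rewrite inordK // ltnS -sum_p (perm_sumn (perm_to_rem p_i)) leq_addr.
by exists (Tuple sz_t); rewrite // inE Et.
Qed.

(* 0-based: index i stands for the pair of consecutive parts (p_i, p_(i+1)),
   0 <= i < size p - 1; there is none when p is empty. *)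
Definition cl (m : nat) (p : seq nat) : nat :=
  #|[set i : 'I_(size p).-1 | nth 0%N p i.+1 == nth 0%N p i %[mod m]]|.

(** * The ring Z[q][[x, y]] and the generating function *)

Notation Zq := {poly int}.
Notation Zqxy := (fps (fps Zq)).

Definition x : Zqxy := fpsX.
Definition y : Zqxy := fpsC fpsX.
Definition q : Zqxy := fpsC (fpsC 'X).

Definition comp_poly (m n d : nat) : Zq :=
  \sum_(t in compositions n d) 'X ^+ cl m (parts t).

(* The sum over n is infinite: the coefficient of x^n, an element of Z[q][[y]],
   is the finite sum over d <= n. *)
Definition F (m : nat) : Zqxy :=
  Fps (fun n => \sum_(0 <= d < n.+1) fpsX ^+ d * fpsC (comp_poly m n d)).

Lemma coef0_x : x 0%N = 0. Proof. by []. Qed.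

(* The denominators of the closed form are units, so that dividing by them has
   its usual meaning. *)
Lemma inner_denom_unit (m a : nat) : (1 <= m)%N -> (1 <= a)%N ->
  1 - x ^+ m - x ^+ a * y * (q - 1) \is a GRing.unit.
Proof.
move=> m_gt0 a_gt0; rewrite fps_unitE !coef0_fpsB !coef0_fpsM !coef0_fpsXn.
rewrite coef0_x !expr0n (gtn_eqF m_gt0) (gtn_eqF a_gt0) !mul0r !subr0.
exact: unitr1.
Qed.

Lemma outer_denom_unit (m : nat) : (1 <= m)%N ->
  1 - \sum_(1 <= a < m.+1)
        x ^+ a * y / (1 - x ^+ m - x ^+ a * y * (q - 1)) \is a GRing.unit.
Proof.
move=> m_gt0; rewrite fps_unitE coef0_fpsB coef0_fps_sum big_nat_cond big1.
  by rewrite subr0; exact: unitr1.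
move=> a; rewrite andbT => /andP[a_gt0 _].
by rewrite !coef0_fpsM coef0_fpsXn coef0_x expr0n (gtn_eqF a_gt0) !mul0r.
Qed.

(* Main.v *)
(** Sort the nonempty compositions by the residue r (1 <= r <= m) of their first
    part mod m, and let F_r be their generating function.  Removing the first
    part k = r + jm leaves an arbitrary composition, and costs a factor q
    exactly when that composition also begins with residue r; hence
    F_r = x^r y / (1 - x^m) * (F + (q - 1) F_r), that is,
    F_r = x^r y / (1 - x^m - x^r y (q - 1)) * F.
    Substituting into F = 1 + \sum_r F_r and solving for F gives the formula. *)
Require Import Defs.
From HB Require Import structures.
From mathcomp Require Import all_boot all_order all_algebra.
Import GRing.Theory.
Local Open Scope ring_scope.

(** * Coefficient extraction in power series *)

Lemma coef_fpsD (R : comNzRingType) (f g : fps R) n : (f + g) n = f n + g n.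
Proof. by []. Qed.

Lemma coef_fps_sum (R : comNzRingType) (I : Type) (r : seq I) (P : pred I)
    (f_ : I -> fps R) n :
  (\sum_(i <- r | P i) f_ i) n = \sum_(i <- r | P i) f_ i n.
Proof.
apply: (big_morph (fun f : fps R => f n)) => //=.
by rewrite if_same.
Qed.

Lemma coef_fps1 (R : comNzRingType) n : (1 : fps R) n = (n == 0)%N%:R.
Proof. by rewrite [LHS]/=; case: eqP. Qed.

Lemma coef_fpsCM (R : comNzRingType) (c : R) (f : fps R) n :
  (fpsC c * f) n = c * f n.
Proof.
rewrite [LHS]big_ord_recl subn0 big1 ?addr0 // => i _.
by rewrite [fpsC c _]/= mul0r.
Qed.

Lemma coef_fpsXM (R : comNzRingType) (f : fps R) n :
  (fpsX * f) n = if n is n'.+1 then f n' else 0.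
Proof.
rewrite [LHS]big_ord_recl /= mul0r add0r; case: n => [|n]; first by rewrite big_ord0.
rewrite big_ord_recl /= mul1r subSS subn0 big1 ?addr0 // => i _.
by rewrite mul0r.
Qed.

Lemma coef_fpsXnM (R : comNzRingType) k (f : fps R) n :
  (fpsX ^+ k * f) n = if (k <= n)%N then f (n - k)%N else 0.
Proof.
elim: k n => [|k IHk] n; first by rewrite expr0 mul1r subn0.
by rewrite exprS -mulrA coef_fpsXM; case: n => // n; rewrite IHk ltnS subSS.
Qed.

Lemma fpsC1 (R : comNzRingType) : fpsC (1 : R) = 1.
Proof. by []. Qed.

Lemma fpsCB (R : comNzRingType) (a b : R) : fpsC (a - b) = fpsC a - fpsC b.
Proof. by apply: fpsP => n /=; case: eqP; rewrite ?subr0. Qed.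

(** * Compositions listed by recursion on the first part *)

Fixpoint comp_seqs (n d : nat) : seq (seq nat) :=
  if d is d'.+1 then
    [seq k :: p | k <- iota 1 n, p <- comp_seqs (n - k) d']
  else if n == 0%N then [:: [::]] else [::].

Lemma mem_comp_seqs n d p : (p \in comp_seqs n d) = is_composition n d p.
Proof.
elim: d n p => [|d IHd] n p.
  rewrite /is_composition size_eq0 /=.
  by case: n p => [|n] [|k p] //=; rewrite andbF.
apply/allpairsPdep/idP => [[k [p' [k_n p'_n ->]]] | ].
  move: k_n p'_n; rewrite mem_iota add1n ltnS IHd => /andP[k_gt0 le_kn].
  case/and3P=> /eqP sz_p p_gt0 /eqP sum_p.
  by rewrite /is_composition /= sz_p p_gt0 sum_p subnKC ?k_gt0 ?eqxx.
case: p => [|k p] // /and3P[/= sz_p /andP[k_gt0 p_gt0] /eqP sum_p].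
exists k, p; split=> //; last first.
  by rewrite IHd /is_composition p_gt0 -eqSS sz_p -sum_p addKn eqxx.
by rewrite mem_iota k_gt0 add1n ltnS -sum_p leq_addr.
Qed.

Lemma uniq_comp_seqs n d : uniq (comp_seqs n d).
Proof.
elim: d n => [|d IHd] n /=; first by case: eqP.
apply: allpairs_uniq_dep => [|k _|]; [exact: iota_uniq | exact: IHd |].
by move=> [k p] [k' p'] _ _ /= [-> ->].
Qed.

(** Passing from tuples to lists exposes the first part: [parts] is injective, and its image of
    [compositions n d] is exactly what [comp_seqs] lists without repetition. *)
Lemma comp_polyE m n d :
  Defs.comp_poly m n d = \sum_(p <- comp_seqs n d) 'X ^+ cl m p.
Proof.
rewrite /Defs.comp_poly -big_enum -(big_map (@parts n d) xpredT (fun p => 'X ^+ cl m p)).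
apply: perm_big; apply: uniq_perm => [||p].
- by rewrite map_inj_uniq ?enum_uniq //; apply: parts_inj.
- exact: uniq_comp_seqs.
rewrite mem_comp_seqs; apply/mapP/idP => [[t]|].
  by rewrite mem_enum => t_n ->; apply/is_compositionP; exists t.
by case/is_compositionP=> t t_n <-; exists t; rewrite ?mem_enum.
Qed.

(** Parts are at least 1, so d parts sum to at least d. Hence the cutoff at d = n in [F] loses no
    term. *)
Lemma comp_poly_gt m n d : (n < d)%N -> Defs.comp_poly m n d = 0.
Proof.
move=> lt_nd; rewrite comp_polyE big_seq big1 // => p.
rewrite mem_comp_seqs => /and3P[/eqP sz_p p_gt0 /eqP sum_p].
suff: (size p <= sumn p)%N by rewrite sz_p sum_p leqNgt lt_nd.
elim: p p_gt0 {sz_p sum_p} => //= k p IHp /andP[k_gt0 /IHp].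
by rewrite -add1n; apply: leq_add.
Qed.

Lemma coef_F m n d : F m n d = Defs.comp_poly m n d.
Proof.
have Xd (e : nat) (c : Zq) : (fpsX ^+ e * fpsC c : fps Zq) d = if d == e then c else 0.
  rewrite coef_fpsXnM [fpsC _ _]/= subn_eq0.
  by case: ltngtP.
rewrite [F m n]/= coef_fps_sum (eq_bigr _ (fun e _ => Xd e _)).
have [le_dn | lt_nd] := leqP d n.
  rewrite (bigD1_seq d) ?iota_uniq ?mem_index_iota //= eqxx big1 ?addr0 // => e.
  by rewrite eq_sym => /negPf->.
rewrite comp_poly_gt // big_nat big1 // => e.
by rewrite ltnS => /= le_en; rewrite gtn_eqF // (leq_ltn_trans le_en).
Qed.

(** * Successions and the first part *)

Definition head_congr (m r : nat) (p : seq nat) : bool :=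
  if p is k :: _ then k == r %[mod m] else false.

Lemma cl_nil m : cl m [::] = 0%N.
Proof. by apply: eq_card0 => -[]. Qed.

(** Index 0 compares k with the head of p, and the later indices are those of p shifted by one. For
    empty p both counts are 0. *)
Lemma cl_cons m k p : cl m (k :: p) = (head_congr m k p + cl m p)%N.
Proof.
have clE s : cl m s =
    (\sum_(i < (size s).-1) (nth 0 s i.+1 == nth 0 s i %[mod m]))%N.
  by rewrite /cl cardsE -sum1_card big_mkcond.
by case: p => [|j p]; rewrite !clE ?big_ord0 //= big_ord_recl.
Qed.

(** For e in {0, 1}, q^e = 1 + (q - 1)e; this linear form splits a sum over p into the full sum and
    one restricted by the head of p. *)
Lemma expX_cl_cons m k p :
  'X ^+ cl m (k :: p) =
  'X ^+ cl m p + ('X - 1) * (if head_congr m k p then 'X ^+ cl m p else 0) :> Zq.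
Proof.
rewrite cl_cons; case: ifP => _; last by rewrite mulr0 addr0.
by rewrite exprS mulrBl mul1r addrC subrK.
Qed.

Lemma head_congr_mod m k r p :
  k = r %[mod m] -> head_congr m k p = head_congr m r p.
Proof. by move=> eq_kr; case: p => //= j p; rewrite eq_kr. Qed.

(** * Compositions sorted by the residue of the first part *)

Definition res_poly (m r n d : nat) : Zq :=
  \sum_(p <- comp_seqs n d | head_congr m r p) 'X ^+ cl m p.

Definition F_res (m r : nat) : Zqxy := Fps (fun n => Fps (res_poly m r n)).

Lemma res_poly0 m r n : res_poly m r n 0 = 0.
Proof.
by rewrite /res_poly /=; case: ifP => _; rewrite ?big_cons ?big_nil.
Qed.

Lemma res_polyS m r n d :
  res_poly m r n d.+1 =
  \sum_(1 <= k < n.+1 | k == r %[mod m])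
     (Defs.comp_poly m (n - k) d + ('X - 1) * res_poly m r (n - k) d).
Proof.
rewrite /res_poly /= big_mkcond big_allpairs_dep /= /index_iota subSS subn0.
rewrite [RHS]big_mkcond; apply: eq_bigr => k _.
case: eqP => eq_kr; last by rewrite big1.
rewrite comp_polyE [X in _ * X]big_mkcond mulr_sumr -big_split /=.
by apply: eq_bigr => p _; rewrite expX_cl_cons (head_congr_mod _ _ _ _ eq_kr).
Qed.

Lemma sum_residues (m j : nat) (c : Zq) :
  (0 < m)%N -> \sum_(1 <= r < m.+1 | j == r %[mod m]) c = c.
Proof.
(* As m is congruent to 0, the range 1..m is traded for 0..m-1, where the only matching residue is
   [j %% m]. *)
move=> m_gt0; rewrite big_mkcond big_nat_recr //= modnn.
have ->: \sum_(1 <= r < m) (if (j %% m == r %% m)%N then c else 0)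
         + (if (j %% m == 0)%N then c else 0)
       = \sum_(0 <= r < m) (if (j %% m == r %% m)%N then c else 0).
  by rewrite [RHS]big_ltn // mod0n addrC.
rewrite (bigD1_seq (j %% m)%N) ?iota_uniq ?mem_index_iota ?ltn_pmod //=.
rewrite modn_mod eqxx big_nat_cond big1 ?addr0 // => r /andP[/andP[_ lt_rm]].
by rewrite (modn_small lt_rm) eq_sym => /negPf->.
Qed.

Lemma F_sum_residues m : (0 < m)%N -> F m = 1 + \sum_(1 <= r < m.+1) F_res m r.
Proof.
move=> m_gt0; apply: fpsP => n; apply: fpsP => d.
rewrite coef_F !coef_fpsD !coef_fps_sum /=.
(* With no parts only the empty composition of 0 remains, which gives the summand 1; otherwise the
   first part selects exactly one r. *)
case: d => [|d].
  rewrite big1 => [|r _]; last exact: res_poly0.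
  rewrite addr0 comp_polyE /=; case: n => [|n]; last by rewrite big_nil.
  by rewrite big_seq1 cl_nil.
rewrite [X in X + _](_ : _ = 0) ?add0r; last by case: (n == 0%N).
rewrite /res_poly; under eq_bigr do rewrite big_mkcond.
rewrite exchange_big comp_polyE big_seq [RHS]big_seq.
apply: eq_bigr => -[|j p]; first by rewrite mem_comp_seqs.
by move=> _; rewrite /= -big_mkcond sum_residues.
Qed.

(** * First parts as a geometric series, and the functional equation *)

Definition residue_series (m r : nat) : Zqxy :=
  Fps (fun k => ((0 < k)%N && (k == r %[mod m])%N)%:R).

(** Multiplication by x^m shifts the exponents r, r + m, r + 2m, ... by one place, so only the first
    one survives the subtraction. *)
Lemma residue_seriesE m r :
  (0 < r <= m)%N -> residue_series m r * (1 - x ^+ m) = x ^+ r.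
Proof.
move=> /andP[r_gt0 le_rm]; rewrite mulrBr mulr1 mulrC.
have m_gt0 := leq_trans r_gt0 le_rm.
apply/eqP; rewrite subr_eq; apply/eqP/fpsP => n.
rewrite coef_fpsD -[x ^+ r]mulr1 !coef_fpsXnM coef_fps1.
have ->: (if (r <= n)%N then ((n - r == 0)%N%:R : fps Zq) else 0) = (n == r)%N%:R.
  by rewrite subn_eq0; case: ltngtP.
rewrite /residue_series /=; have [le_mn | lt_nm] := leqP m n; last first.
  rewrite addr0; case: n lt_nm => [|n] lt_nm; first by rewrite (ltn_eqF r_gt0).
  rewrite (modn_small lt_nm); congr (_ %:R).
  move: le_rm; rewrite leq_eqVlt => /predU1P[-> | lt_rm].
    by rewrite modnn (ltn_eqF lt_nm).
  by rewrite modn_small.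
rewrite -{1 2 3}(subnK le_mn) modnDr addn_gt0 m_gt0 orbT /=.
(* At n = m the shifted series contributes 0, since it has no constant term; the coefficient is then
   1 exactly when r = m. *)
case: (n - m)%N => [|k] /=.
  rewrite addr0 add0n mod0n; congr (_ %:R).
  move: le_rm; rewrite leq_eqVlt => /predU1P[-> | lt_rm].
    by rewrite modnn !eqxx.
  by rewrite modn_small // (ltn_eqF r_gt0) (gtn_eqF lt_rm).
have lt_r: (r < k.+1 + m)%N by rewrite ltnS (leq_trans le_rm) ?leq_addl.
by rewrite (gtn_eqF lt_r) add0r.
Qed.

(** This is the recurrence [res_polyS] in product form: [residue_series] carries the size of the
    removed part and [y] counts it. *)
Lemma F_res_convolution m r :
  F_res m r = residue_series m r * (y * (F m + (q - 1) * F_res m r)).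
Proof.
have q1 : q - 1 = fpsC (fpsC ('X - 1)) by rewrite !fpsCB !fpsC1.
apply: fpsP => n; apply: fpsP => d.
rewrite [in RHS](_ : (residue_series m r * _) n = \sum_(k < n.+1)
  residue_series m r k * (y * (F m + (q - 1) * F_res m r)) (n - k)%N) //.
rewrite coef_fps_sum [LHS]/=.
have term k : (residue_series m r k * (y * (F m + (q - 1) * F_res m r)) (n - k)%N) d
    = if (0 < k)%N && (k == r %[mod m])%N then
        if d is d'.+1 then
          Defs.comp_poly m (n - k) d' + ('X - 1) * res_poly m r (n - k) d' else 0
      else 0.
  rewrite [residue_series m r k]/=; case: (_ && _); last by rewrite mul0r /= if_same.
  rewrite mul1r coef_fpsCM coef_fpsXM; case: d => // d.
  by rewrite !coef_fpsD q1 !coef_fpsCM coef_F.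
rewrite (eq_bigr _ (fun (k : 'I_n.+1) _ => term k)).
case: d {term} => [|d].
  by rewrite res_poly0 big1 // => k _; rewrite if_same.
rewrite res_polyS big_mkcond big_add1 /= big_mkord big_ord_recl add0r.
by apply: eq_bigr => k _.
Qed.

Lemma F_resE m r : (0 < r <= m)%N ->
  F_res m r = x ^+ r * y / (1 - x ^+ m - x ^+ r * y * (q - 1)) * F m.
Proof.
move=> r_m; have [r_gt0 le_rm] := andP r_m.
have UD := @inner_denom_unit m r (leq_trans r_gt0 le_rm) r_gt0.
apply: (mulIr UD); rewrite [RHS]mulrAC divrK // mulrBr.
(* The factor 1 - x^m clears the geometric series; the resulting (q - 1) term then cancels against
   the rest of the denominator. *)
rewrite {1}F_res_convolution mulrAC residue_seriesE // mulrDr mulrDr.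
by rewrite [X in _ - X]mulrC !mulrA addrK.
Qed.

Theorem corollary3 (m : nat) (hm : (1 <= m)%N) :
  F m = (1 - \sum_(1 <= a < m.+1)
               x ^+ a * y / (1 - x ^+ m - x ^+ a * y * (q - 1)))^-1.
Proof.
have UD := outer_denom_unit hm.
apply: (mulIr UD); rewrite mulVr // mulrBr mulr1 mulrC mulr_suml.
(* Each fraction times [F m] is a series [F_res m r], so the difference collapses to 1. *)
rewrite {1}(F_sum_residues m hm) [X in _ - X](_ : _ = \sum_(1 <= r < m.+1) F_res m r).
  by rewrite addrK.
by rewrite big_nat [RHS]big_nat; apply: eq_bigr => r r_m; rewrite F_resE.
Qed.
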